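(* Let $(W,B)$ be a spherical latin bitrade and let $\mathcal{A}^*$ be the finite abelian group defined in the context. Then $W$ embeds in $\mathcal{A}^*$.
   Context: A latin bitrade is a pair $(W,B)$ of non-empty finite sets of triples (row, column, symbol), any two distinct triples in the same set agreeing in at most one coordinate, such that for each $(r,c,s)\in W$ (resp. $B$) there exist unique $r'\ne r$, $c'\ne c$, $s'\ne s$ with $(r',c,s),(r,c',s),(r,c,s')\in B$ (resp. $W$). It is connected if it is not the union of two latin bitrades $(W',B')$, $(W'',B'')$ with $W'\cap W''=\emptyset$. With $R,C,S$ the pairwise disjoint sets of rows, columns, symbols used: for each row $r$ let $\psi_r(s)=s'$ iff $(r,c,s)\in W$, $(r,c,s')\in B$ for some $c$, with analogous permutations for columns and symbols; the bitrade is separated if all are single cycles. It is spherical if separated, connected and $2+|W|-|R|-|C|-|S|=0$. Let $\mathcal{V}=R\cup C\cup S$ be commuting indeterminates, fix $(r_0,c_0,s_0)\in W$, and $\mathcal{A}^*=\langle \mathcal{V}\mid r+c+s=0 \text{ for all }(r,c,s)\in W;\ r_0=c_0=s_0=0\rangle$. $W$ embeds in an abelian group $H$ if there are injections $f:R\to H$, $h:C\to H$, $k:S\to H$ with $f(r)+h(c)=k(s)$ for all $(r,c,s)\in W$. *)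

(* Defs.v *)
From HB Require Import structures.
From mathcomp Require Import all_boot all_order all_algebra.
From mathcomp Require Import boolp.

Set Implicit Arguments.
Unset Strict Implicit.
Unset Printing Implicit Defensive.

Import GRing.Theory.
Local Open Scope ring_scope.

Section PresentedAbelianGroup.
Variables (X : finType) (rels : seq {ffun X -> int}).

Definition relation_subgroup : {pred {ffun X -> int}} :=
  fun v => `[< inIntSpan (in_tuple rels) v >].

Fact relation_subgroup_zmod : zmod_closed relation_subgroup.
Proof.
split=> [|u v /asboolP[a ->] /asboolP[b ->]]; apply/asboolP.
  by exists [ffun=> 0]; rewrite big1 // => i _; rewrite ffunE mulr0z.
exists [ffun i => a i - b i]; rewrite -sumrB.
by apply: eq_bigr => i _; rewrite ffunE mulrzBr.
Qed.

HB.instance Definition _ :=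
  GRing.isZmodClosed.Build {ffun X -> int} relation_subgroup
    relation_subgroup_zmod.

(* < X | v = 0 for all v in rels >, as the quotient of the free abelian group *)
(* Z^X by the subgroup spanned by rels.                                       *)
Definition presented_abgroup : zmodType := Quotient.quot relation_subgroup.

End PresentedAbelianGroup.

Section LatinBitrades.
Variable T : finType.
Implicit Types (W B : {set T * T * T}) (x r c s : T).

(* A triple (r, c, s) : T * T * T is ((r, c), s). In a latin bitrade (W, B)   *)
(* the rows, columns and symbols occurring in B are those occurring in W.     *)
Definition rows W : {set T} := [set t.1.1 | t in W].
Definition cols W : {set T} := [set t.1.2 | t in W].
Definition syms W : {set T} := [set t.2 | t in W].

Definition agreements (t u : T * T * T) : nat :=
  ((t.1.1 == u.1.1) + (t.1.2 == u.1.2) + (t.2 == u.2))%N.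

Definition partial_latin W : Prop :=
  forall t u, t \in W -> u \in W -> t != u -> (agreements t u <= 1)%N.

Definition has_mates W B : Prop :=
  forall r c s, (r, c, s) \in W ->
    [/\ exists! r', r' <> r /\ (r', c, s) \in B,
        exists! c', c' <> c /\ (r, c', s) \in B
      & exists! s', s' <> s /\ (r, c, s') \in B].

Record latin_bitrade W B : Prop := LatinBitrade {
  bitrade_W_neq0 : W != set0;
  bitrade_B_neq0 : B != set0;
  bitrade_rows_cols : [disjoint rows W & cols W];
  bitrade_rows_syms : [disjoint rows W & syms W];
  bitrade_cols_syms : [disjoint cols W & syms W];
  bitrade_W_partial_latin : partial_latin W;
  bitrade_B_partial_latin : partial_latin B;
  bitrade_W_mates : has_mates W B;
  bitrade_B_mates : has_mates B W
}.

Definition connected W B : Prop :=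
  ~ exists W' B' W'' B'',
      [/\ latin_bitrade W' B', latin_bitrade W'' B'',
          W = W' :|: W'', B = B' :|: B'' & W' :&: W'' = set0].

(* The graphs of the permutations attached to a row r (acting on the symbols  *)
(* of row r), a column c (on the rows of column c) and a symbol s (on the     *)
(* columns containing s), obtained from each other by rotating coordinates.   *)
Definition psi_row W B r : rel T :=
  fun s s' => [exists c, ((r, c, s) \in W) && ((r, c, s') \in B)].
Definition psi_col W B c : rel T :=
  fun r r' => [exists s, ((r, c, s) \in W) && ((r', c, s) \in B)].
Definition psi_sym W B s : rel T :=
  fun c c' => [exists r, ((r, c, s) \in W) && ((r, c', s) \in B)].

Definition row_syms W r : {set T} := [set s | [exists c, (r, c, s) \in W]].
Definition col_rows W c : {set T} := [set r | [exists s, (r, c, s) \in W]].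
Definition sym_cols W s : {set T} := [set c | [exists r, (r, c, s) \in W]].

(* The permutation of D with graph e is one cycle (x_1 x_2 ... x_n).          *)
Definition single_cycle (e : rel T) (D : {set T}) : Prop :=
  exists2 p : seq T, ucycle e p & p =i D.

Definition separated W B : Prop :=
  [/\ forall r, r \in rows W -> single_cycle (psi_row W B r) (row_syms W r),
      forall c, c \in cols W -> single_cycle (psi_col W B c) (col_rows W c)
    & forall s, s \in syms W -> single_cycle (psi_sym W B s) (sym_cols W s)].

Record spherical W B : Prop := Spherical {
  spherical_bitrade : latin_bitrade W B;
  spherical_separated : separated W B;
  spherical_connected : connected W B;
  spherical_genus0 :
    2 + #|W|%:Z - #|rows W|%:Z - #|cols W|%:Z - #|syms W|%:Z = 0 :> int
}.

Definition vars W : {set T} := rows W :|: cols W :|: syms W.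

(* The free generator of Z^(vars W) named x, when x \in vars W. *)
Definition gen W x : {ffun {v : T | v \in vars W} -> int} :=
  [ffun v => (val v == x)%:R].

Definition Astar_rels W r0 c0 s0 : seq {ffun {v : T | v \in vars W} -> int} :=
  [seq gen W t.1.1 + gen W t.1.2 + gen W t.2 | t <- enum W]
    ++ [:: gen W r0; gen W c0; gen W s0].

Definition Astar W r0 c0 s0 : zmodType :=
  presented_abgroup (Astar_rels W r0 c0 s0).

(* Only the values of f, h and k on rows W, cols W and syms W matter. *)
Definition embeds_in W (H : zmodType) : Prop :=
  exists f h k : T -> H,
    [/\ {in rows W &, injective f}, {in cols W &, injective h},
        {in syms W &, injective k}
      & forall r c s, (r, c, s) \in W -> f r + h c = k s].

End LatinBitrades.

(* Main.v *)
Require Import Defs.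
From mathcomp Require Import all_boot all_order all_algebra boolp zify ring.

(* If two rows r1 and r2 coincide in A*, there is x : W -> Z summing to 0     *)
(* over every column and every symbol, and to [r = r1] - [r = r2] over row r. *)
(* The triples of W are the edges of a connected bipartite graph on columns   *)
(* and symbols, drawn on the sphere with the rows as faces; x is a cycle of   *)
(* this graph, so by a rank count from Euler's formula it bounds a potential  *)
(* y on the rows: x t = y r - y r' for t = (r, c, s) in W with mate           *)
(* (r', c, s) in B. Let U be the set of rows where y is maximal. Since the    *)
(* sums of x over the rows of U add up to at most 1, exactly one triple of W  *)
(* leads out of U, and by balance exactly one leads into U. The triples       *)
(* crossing the boundary of U form a cycle of the graph, hence these two      *)
(* share column and symbol, against the latin property. Columns and symbols   *)
(* follow by rotating coordinates.                                            *)

Set Implicit Arguments.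
Unset Strict Implicit.
Unset Printing Implicit Defensive.

Import Order.TTheory GRing.Theory Num.Theory.
Local Open Scope ring_scope.

(** Rows and columns are sent to their classes, symbols to minus theirs, so the issue is that no two
    generators of the same kind are identified. If two were, their difference would be an integer
    combination of the relations. Taking the coefficient of each triple as its weight, and
    subtracting the total weight at the base triple to absorb the relations killing [r0], [c0],
    [s0], gives one x on W whose sums over rows, columns and symbols are the coefficients of the
    difference ([Astar_relation_balanced]). That x bounds a potential on the rows because a sphere
    has no first homology: [sphere_cycle_boundary] gets this over the rationals from the dimension
    count [kermx_sub_of_rank]. A maximum principle for the potential, sharpened by the integrality
    of x, then gives the contradiction ([sphere_row_separation]). [bitrade_sphere] puts the given
    bitrade in this setting, and [sphere_rot] passes from rows to columns and symbols. *)

(** * Linear algebra, transport of sums, and abstract genus-0 bitrades *)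

(** Exactness at the middle of a complex faces - edges - vertices: each of the two kernels is at
    most a line, so [b] has rank at least k - 1, while the kernel of [a] has dimension at most e -
    (l - 1) = k - 1. *)
Lemma kermx_sub_of_rank (K : fieldType) (k e l : nat) (b : 'M[K]_(k, e))
    (a : 'M[K]_(e, l)) (v : 'rV[K]_k) (w : 'rV[K]_l) :
    b *m a = 0 -> (kermx b <= v)%MS -> (kermx a^T <= w)%MS ->
    e.+2 = (k + l)%N -> (kermx a <= b)%MS.
Proof.
move=> ba0 kerb kera ekl.
have sub : (b <= kermx a)%MS by apply/sub_kermxP.
rewrite -(mxrank_leqif_sup sub) eqn_leq mxrankS //= mxrank_ker.
have := leq_trans (mxrankS kerb) (rank_leq_row v).
have := leq_trans (mxrankS kera) (rank_leq_row w).
by rewrite !mxrank_ker mxrank_tr; lia.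
Qed.

(** Both sides equal a sum of [g (rF f)] over black triples, reindexed by [b'], which keeps the row,
    or by [b]. At a column or symbol, the rows on the two sides of its edges thus agree with
    multiplicity. *)
Lemma sum_transport (M : nmodType) (E F K R : finType) (b b' : E -> F)
    (qE : E -> K) (qF : F -> K) (rE : E -> R) (rF : F -> R)
    (P : pred K) (g : R -> M) :
    bijective b -> bijective b' -> (forall e, qF (b e) = qE e) ->
    (forall e, qF (b' e) = qE e) -> (forall e, rF (b' e) = rE e) ->
  \sum_(e | P (qE e)) g (rE e) = \sum_(e | P (qE e)) g (rF (b e)).
Proof.
move=> bb bb' qb qb' rb'.
transitivity (\sum_(f | P (qF f)) g (rF f)).
  rewrite [RHS](reindex b'); last exact: onW_bij.
  by apply: eq_big => e; rewrite ?qb' // rb'.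
rewrite (reindex b); last exact: onW_bij.
by apply: eq_bigl => e; rewrite qb.
Qed.

(* A bitrade of genus 0, with white triples E, black triples F, and b1, b2,   *)
(* b3 sending a white triple to the black one that differs from it in row,    *)
(* column, symbol respectively.                                               *)
Record sphere (E F R C S : finType) (rE : E -> R) (cE : E -> C) (sE : E -> S)
    (rF : F -> R) (cF : F -> C) (sF : F -> S) (b1 b2 b3 : E -> F) : Prop :=
  Sphere {
    sphere_bij1 : bijective b1;
    sphere_bij2 : bijective b2;
    sphere_bij3 : bijective b3;
    sphere_c1 : forall e, cF (b1 e) = cE e;
    sphere_s1 : forall e, sF (b1 e) = sE e;
    sphere_r2 : forall e, rF (b2 e) = rE e;
    sphere_s2 : forall e, sF (b2 e) = sE e;
    sphere_r3 : forall e, rF (b3 e) = rE e;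
    sphere_c3 : forall e, cF (b3 e) = cE e;
    sphere_latin_cs : forall e e', cE e = cE e' -> sE e = sE e' -> e = e';
    sphere_latin_rs : forall e e', rE e = rE e' -> sE e = sE e' -> e = e';
    sphere_latin_rc : forall e e', rE e = rE e' -> cE e = cE e' -> e = e';
    sphere_surj_r : forall r, exists e, rE e = r;
    sphere_surj_c : forall c, exists e, cE e = c;
    sphere_surj_s : forall s, exists e, sE e = s;
    sphere_conn : forall (P : pred E) (Q : pred F),
      (forall e, P e = Q (b1 e)) -> (forall e, P e = Q (b2 e)) ->
      (forall e, P e = Q (b3 e)) -> forall e e', P e = P e';
    sphere_euler : #|E|.+2 = (#|R| + #|C| + #|S|)%N
  }.

Lemma sphere_rot (E F R C S : finType) (rE : E -> R) (cE : E -> C) (sE : E -> S)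
    (rF : F -> R) (cF : F -> C) (sF : F -> S) (b1 b2 b3 : E -> F) :
  sphere rE cE sE rF cF sF b1 b2 b3 -> sphere cE sE rE cF sF rF b2 b3 b1.
Proof.
case=> ? ? ? ? ? ? ? ? ? ? lrs lrc ? ? ? conn eul; split=> //.
- by move=> e e' ? ?; apply: lrs.
- by move=> e e' ? ?; apply: lrc.
- by move=> P Q ? ? ?; apply: (conn P Q).
- by rewrite eul -addnA addnC.
Qed.

(** * Connectedness, homology and the maximum principle on the sphere *)

Section SphereTheory.
Variables (E F R C S : finType) (rE : E -> R) (cE : E -> C) (sE : E -> S).
Variables (rF : F -> R) (cF : F -> C) (sF : F -> S) (b1 b2 b3 : E -> F).
Hypothesis Sph : sphere rE cE sE rF cF sF b1 b2 b3.

(** Connectedness of the dual graph: [b2] and [b3] keep the row, so only crossings by [b1] have to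
    be checked. *)
Lemma sphere_conn_row (P : pred R) :
  (forall e, P (rE e) = P (rF (b1 e))) -> forall r r', P r = P r'.
Proof.
move=> h r r'; have [e <-] := sphere_surj_r Sph r.
have [e' <-] := sphere_surj_r Sph r'.
apply: (sphere_conn Sph (P := P \o rE) (Q := P \o rF)) => e1 //=.
  by rewrite (sphere_r2 Sph).
by rewrite (sphere_r3 Sph).
Qed.

(** Connectedness of the bipartite graph: through [b1], every black triple has the column and symbol
    of a white one. *)
Lemma sphere_conn_col_sym (P : pred C) (Q : pred S) :
    (forall e, P (cE e) = Q (sE e)) ->
  (forall c c', P c = P c') /\ (forall c s, P c = Q s).
Proof.
move=> h; have hF f : P (cF f) = Q (sF f).
  have [g _ gK] := sphere_bij1 Sph.
  by rewrite -(gK f) (sphere_c1 Sph) (sphere_s1 Sph).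
have hE e e' : P (cE e) = P (cE e').
  apply: (sphere_conn Sph (P := P \o cE) (Q := P \o cF)) => e1 /=.
  - by rewrite (sphere_c1 Sph).
  - by rewrite hF (sphere_s2 Sph).
  - by rewrite (sphere_c3 Sph).
split=> [c c'|c s]; have [e <-] := sphere_surj_c Sph c.
  by have [e' <-] := sphere_surj_c Sph c'.
by have [e' <-] := sphere_surj_s Sph s; rewrite -h.
Qed.

(* The vanishing of the first homology of the sphere: x is a cycle of the     *)
(* bipartite graph on C + S with edge set E, whose faces are the rows.        *)
Lemma sphere_cycle_boundary (x : E -> rat) :
    (forall c, \sum_(e | cE e == c) x e = 0) ->
    (forall s, \sum_(e | sE e == s) x e = 0) ->
  exists y : R -> rat, forall e, x e = y (rE e) - y (rF (b1 e)).
Proof.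
move=> xc xs.
pose inc e (v : C + S) : bool :=
  match v with inl c => cE e == c | inr s => sE e == s end.
(* The incidence [a] is unsigned: the graph is bipartite, so changing signs on [S] gives the usual
   boundary map. The two faces along the edge e are the row of e and that of [b1 e]. *)
pose a : 'M[rat]_(#|E|, #|{: C + S}|) :=
  \matrix_(i, j) (inc (enum_val i) (enum_val j))%:R.
pose b : 'M[rat]_(#|R|, #|E|) :=
  \matrix_(i, j) ((rE (enum_val j) == enum_val i)%:R
                  - (rF (b1 (enum_val j)) == enum_val i)%:R).
have sum_inc (z : E -> rat) j : \sum_(i < #|E|) z (enum_val i) * a i j
    = \sum_(e | inc e (enum_val j)) z e.
  rewrite [RHS]big_mkcond [RHS]big_enum_val /=; apply: eq_bigr => i _.
  by rewrite mxE; case: ifP; rewrite ?mulr1 ?mulr0.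
(* Around each vertex the rows of the edges cancel against the rows of their mates. *)
have ba0 : b *m a = 0.
  apply/matrixP => i j; rewrite !mxE.
  under eq_bigr => k _ do rewrite mxE.
  rewrite (sum_inc (fun e => (rE e == enum_val i)%:R
                            - (rF (b1 e) == enum_val i)%:R)) sumrB.
  apply/eqP; rewrite subr_eq0; apply/eqP.
  case: (enum_val j) => [c|s] /=.
    exact: (sum_transport (pred1 c) (fun r => (r == enum_val i)%:R)
      (sphere_bij1 Sph) (sphere_bij3 Sph) (sphere_c1 Sph) (sphere_c3 Sph)
      (sphere_r3 Sph)).
  exact: (sum_transport (pred1 s) (fun r => (r == enum_val i)%:R)
      (sphere_bij1 Sph) (sphere_bij2 Sph) (sphere_s1 Sph) (sphere_s2 Sph)
      (sphere_r2 Sph)).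
have mulb (u : 'rV[rat]_#|R|) e :
    (u *m b) 0 (enum_rank e) = u 0 (enum_rank (rE e))
                               - u 0 (enum_rank (rF (b1 e))).
  rewrite mxE; under eq_bigr => k _ do rewrite mxE enum_rankK mulrBr.
  rewrite sumrB; congr (_ - _).
    rewrite (bigD1 (enum_rank (rE e))) //= enum_rankK eqxx mulr1 big1 ?addr0 //.
    move=> k /negPf nk; rewrite -(inj_eq enum_rank_inj) enum_valK eq_sym nk.
    by rewrite mulr0.
  rewrite (bigD1 (enum_rank (rF (b1 e)))) //= enum_rankK eqxx mulr1.
  rewrite big1 ?addr0 // => k /negPf nk.
  by rewrite -(inj_eq enum_rank_inj) enum_valK eq_sym nk mulr0.
have kerb : (kermx b <= (const_mx 1 : 'rV[rat]_#|R|))%MS.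
  apply/rV_subP => u /sub_kermxP ub0.
  have cst r r' : u 0 (enum_rank r) = u 0 (enum_rank r').
    apply/eqP; rewrite -(@sphere_conn_row
      (fun r => u 0 (enum_rank r) == u 0 (enum_rank r')) _ r') ?eqxx // => e.
    have /eqP := mulb u e; rewrite ub0 mxE eq_sym subr_eq0.
    by move/eqP->.
  have [i _|u0] := pickP 'I_#|R|; last first.
    by rewrite (_ : u = 0) ?sub0mx //; apply/rowP=> i; have := u0 i.
  apply/sub_rVP; exists (u 0 i); apply/rowP => k; rewrite !mxE mulr1.
  by rewrite -(enum_valK k) -(enum_valK i).
(* As [a] is unsigned, a vector killed by [a^T] changes sign along each edge. *)
pose w : 'rV[rat]_#|{: C + S}| :=
  \row_j (if enum_val j is inl _ then 1 else -1).
have mula (u : 'rV[rat]_#|{: C + S}|) e :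
    (u *m a^T) 0 (enum_rank e) = u 0 (enum_rank (inl (cE e)))
                               + u 0 (enum_rank (inr (sE e))).
  rewrite mxE; under eq_bigr => k _ do rewrite !mxE enum_rankK.
  rewrite (bigD1 (enum_rank (inl (cE e)))) //= enum_rankK /= eqxx mulr1.
  congr (_ + _); rewrite (bigD1 (enum_rank (inr (sE e)))) /=; last first.
    by rewrite (inj_eq enum_rank_inj).
  rewrite enum_rankK /= eqxx mulr1 big1 ?addr0 // => k.
  rewrite -[k]enum_valK !(inj_eq enum_rank_inj) enum_rankK.
  case: (enum_val k) => [c|s] /=.
    rewrite [cE e == c]eq_sym => /andP[/negPf h _].
    by rewrite (h : (c == cE e) = false) mulr0.
  rewrite [sE e == s]eq_sym => /negPf h.
  by rewrite (h : (s == sE e) = false) mulr0.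
have kera : (kermx a^T <= w)%MS.
  apply/rV_subP => u /sub_kermxP ua0.
  have opp e : u 0 (enum_rank (inl (cE e))) = - u 0 (enum_rank (inr (sE e))).
    by apply/eqP; rewrite -addr_eq0 -mula ua0 mxE.
  have [c _|noC] := pickP C; last first.
    have [i _|u0] := pickP 'I_#|{: C + S}|; last first.
      by rewrite (_ : u = 0) ?sub0mx //; apply/rowP=> i; have := u0 i.
    case: (enum_val i) => [c|s]; first by have := noC c.
    by have [e _] := sphere_surj_s Sph s; have := noC (cE e).
  set z := u 0 (enum_rank (inl c)).
  have [h1 h2] := @sphere_conn_col_sym
    (fun c' => u 0 (enum_rank (inl c')) == z)
    (fun s' => u 0 (enum_rank (inr s')) == - z)
    (fun e => etrans (congr1 (eq_op^~ z) (opp e)) (eqr_oppLR _ _)).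
  apply/sub_rVP; exists z; apply/rowP => k; rewrite -(enum_valK k) !mxE.
  rewrite enum_rankK; case: (enum_val k) => [c'|s'].
    by rewrite mulr1; apply/eqP; rewrite (h1 c' c).
  by rewrite mulrN1; apply/eqP; rewrite -(h2 c s').
have ker_sub : (kermx a <= b)%MS.
  apply: (kermx_sub_of_rank ba0 kerb kera).
  by rewrite card_sum addnA (sphere_euler Sph).
have : ((\row_i x (enum_val i)) <= b)%MS.
  apply: submx_trans ker_sub; apply/sub_kermxP/rowP => j.
  rewrite !mxE; under eq_bigr => k _ do rewrite mxE.
  by rewrite sum_inc; case: (enum_val j) => /=.
case/submxP => u /rowP xu; exists (fun r => u 0 (enum_rank r)) => e.
by have := xu (enum_rank e); rewrite mulb mxE enum_rankK.
Qed.

Lemma sphere_row_separation (x : E -> int) (r1 r2 : R) :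
    (forall c, \sum_(e | cE e == c) x e = 0) ->
    (forall s, \sum_(e | sE e == s) x e = 0) ->
    (forall r, \sum_(e | rE e == r) x e = (r == r1)%:R - (r == r2)%:R) ->
  r1 = r2.
Proof.
move=> xc xs xr; apply/eqP; apply: contraT => r12.
have [y xy] : exists y : R -> rat,
    forall e, (x e)%:~R = y (rE e) - y (rF (b1 e)).
  by apply: sphere_cycle_boundary => [c|s]; rewrite -rmorph_sum ?xc ?xs.
have [m _ ymax] := @Order.TotalTheory.arg_maxP _ _ _ r1 predT y isT.
pose U r := y r == y m.
pose out e := U (rE e) && ~~ U (rF (b1 e)).
pose into e := ~~ U (rE e) && U (rF (b1 e)).
(* At each vertex as many edges enter [U] as leave it: transport the indicator of [U] and cancel the
   edges with both sides in [U]. *)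
have crossing (K : finType) (qE : E -> K) (qF : F -> K) (b' : E -> F) k :
    bijective b' -> (forall e, qF (b1 e) = qE e) ->
    (forall e, qF (b' e) = qE e) -> (forall e, rF (b' e) = rE e) ->
    \sum_(e | qE e == k) (into e)%:R = \sum_(e | qE e == k) (out e)%:R :> int.
  move=> bb' q1 q' r'.
  have := sum_transport (pred1 k) (fun r => (U r)%:R : int)
      (sphere_bij1 Sph) bb' q1 q' r'.
  pose both e := U (rE e) && U (rF (b1 e)).
  have -> : \sum_(e | pred1 k (qE e)) (U (rE e))%:R =
      \sum_(e | qE e == k) (both e)%:R + \sum_(e | qE e == k) (out e)%:R :> int.
    rewrite -big_split; apply: eq_bigr => e _ /=; rewrite /both /out.
    by case: (U (rE e)); case: (U (rF (b1 e))).
  have -> : \sum_(e | pred1 k (qE e)) (U (rF (b1 e)))%:R =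
      \sum_(e | qE e == k) (both e)%:R + \sum_(e | qE e == k) (into e)%:R :> int.
    rewrite -big_split; apply: eq_bigr => e _ /=; rewrite /both /into.
    by case: (U (rE e)); case: (U (rF (b1 e))).
  by move/addrI.
have into_out (K : finType) (qE : E -> K) (qF : F -> K) (b' : E -> F) t :
    bijective b' -> (forall e, qF (b1 e) = qE e) ->
    (forall e, qF (b' e) = qE e) -> (forall e, rF (b' e) = rE e) ->
    out t -> exists2 t', into t' & qE t' = qE t.
  move=> bb' q1 q' r' ot.
  have [t' /andP[/eqP]|noin] := pickP [pred e | (qE e == qE t) && into e].
    by exists t'.
  have /eqP := crossing _ _ _ _ (qE t) bb' q1 q' r'.
  rewrite big1 => [|e qe]; last by have := noin e; rewrite /= qe /= => ->.
  rewrite lt_eqF // (bigD1 t) //= ot ltr_pwDl //.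
  by apply: sumr_ge0 => e _; rewrite ler0n.
(* A constant map to [unit] treats all edges as meeting one vertex. *)
have total : \sum_e (into e)%:R = \sum_e (out e)%:R :> int.
  exact: (crossing _ (fun=> tt) (fun=> tt) b2 tt (sphere_bij2 Sph) _ _
    (sphere_r2 Sph)).
have x_ge0 e : U (rE e) -> 0 <= x e.
  move=> /eqP Ue; rewrite -(ler0z rat) xy Ue subr_ge0; exact: ymax.
(* The drop from the maximum is positive and [x e] is an integer. *)
have x_ge1 e : out e -> 1 <= x e.
  case/andP=> Ue nUe; rewrite -gtz0_ge1 lt_neqAle x_ge0 // andbT eq_sym.
  by rewrite -(intr_eq0 rat) xy (eqP Ue) subr_eq0 eq_sym.
(* Over the rows of [U], [x] is nonnegative and sums to [r1 in U] - [r2 in U]. *)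
have out_le1 : \sum_e (out e)%:R <= 1 :> int.
  apply: (@le_trans _ _ (\sum_(e | U (rE e)) x e)).
    rewrite [leRHS]big_mkcond; apply: ler_sum => e _.
    have [Ue|nUe] := boolP (U (rE e)); last by rewrite /out (negPf nUe).
    by have [/x_ge1|_] := boolP (out e); last exact: x_ge0.
  rewrite (partition_big rE U) //=.
  rewrite (eq_bigr (fun r => (r == r1)%:R - (r == r2)%:R)); last first.
    move=> r Ur; rewrite -xr; apply: eq_bigl => e.
    by case: eqP => [->|_]; rewrite ?Ur ?andbF.
  have delta_sum s : \sum_(r | U r) (r == s)%:R = (U s)%:R :> int.
    rewrite big_mkcond (bigD1 s) //= eqxx big1 ?addr0; first by case: ifP.
    by move=> r /negPf->; rewrite if_same.
  by rewrite sumrB !delta_sum; case: (U r1); case: (U r2).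
have into_uniq t t' : into t -> into t' -> t = t'.
  move=> it it'; apply/eqP; apply: contraT => tt'.
  move: out_le1; rewrite -total (bigD1 t) //= (bigD1 t') 1?eq_sym //= it it'.
  rewrite addrA leNgt ltr_wpDr //.
  by apply: sumr_ge0 => e _; rewrite ler0n.
(* With no crossing, connectedness makes [y] constant and [x] zero, but [x] sums to 1 over row
   [r1]. *)
have [t ot] : exists t, out t.
  have [t ot|noout] := pickP out; first by exists t.
  have noin e : into e = false.
    move/eqP: total; rewrite [X in _ == X]big1 => [|e' _]; last by rewrite noout.
    rewrite psumr_eq0 => [/allP/(_ e (mem_index_enum e))|e' _].
      by case: (into e).
    by rewrite ler0n.
  have UT r : U r.
    rewrite (@sphere_conn_row U _ r m) ?/U ?eqxx // => e.
    by have := noin e; have := noout e; rewrite /into /out /U; do 2!case: eqP.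
  have /eqP := xr r1; rewrite big1 ?eqxx ?(negPf r12) // => e _.
  by apply/eqP; rewrite -(intr_eq0 rat) xy (eqP (UT _)) (eqP (UT _)) subrr.
(* By uniqueness, the triple entering [U] in the column of [t] is also the one in its symbol. *)
have [t' it' ct'] := into_out _ _ _ _ _ (sphere_bij3 Sph) (sphere_c1 Sph)
  (sphere_c3 Sph) (sphere_r3 Sph) ot.
have [t'' it'' st''] := into_out _ _ _ _ _ (sphere_bij2 Sph) (sphere_s1 Sph)
  (sphere_s2 Sph) (sphere_r2 Sph) ot.
have ett : t' = t by apply: (sphere_latin_cs Sph) => //;
  rewrite (into_uniq t' t'').
by move: it' ot; rewrite ett /into /out => /andP[/negPf->].
Qed.
End SphereTheory.

(** * Matching of triples, and membership in the relation subgroup *)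

(** Here [q] will forget one coordinate: the latin property makes it injective on each side, and the
    mates give both sides the same image. *)
Lemma mate_bijection (X K : finType) (A D : {set X}) (q : X -> K) :
    {in A &, injective q} -> {in D &, injective q} ->
    (forall t, t \in A -> exists2 u, u \in D & q u = q t) ->
    (forall u, u \in D -> exists2 t, t \in A & q t = q u) ->
  exists2 b : {t | t \in A} -> {u | u \in D},
    bijective b & forall e, q (val (b e)) = q (val e).
Proof.
move=> injA injD AD DA.
have to e : {f : {u | u \in D} | q (val f) = q (val (e : {t | t \in A}))}.
  by apply: cid; case: (AD _ (valP e)) => u uD qu; exists (exist _ u uD).
have from f : {e : {t | t \in A} | q (val e) = q (val (f : {u | u \in D}))}.
  by apply: cid; case: (DA _ (valP f)) => u uA qu; exists (exist _ u uA).
exists (fun e => sval (to e)) => [|e]; last exact: svalP (to e).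
exists (fun f => sval (from f)) => e; apply: val_inj.
  by apply: injA; try exact: valP; rewrite (svalP (from _)) (svalP (to _)).
by apply: injD; try exact: valP; rewrite (svalP (to _)) (svalP (from _)).
Qed.

Lemma relation_subgroup_ind (X : finType) (rels : seq {ffun X -> int})
    (P : {ffun X -> int} -> Prop) :
    P 0 -> (forall u v, P u -> P v -> P (u - v)) ->
    (forall v, v \in rels -> P v) ->
  forall v, v \in relation_subgroup rels -> P v.
Proof.
move=> P0 PB Prels v /asboolP[a ->].
have PN u : P u -> P (- u) by rewrite -sub0r; apply: PB.
have PD u w : P u -> P w -> P (u + w).
  by move=> Pu Pw; rewrite -[w]opprK; apply/PB/PN.
apply: (big_ind P) => // i _.
have Pi : P (in_tuple rels)`_i by apply: Prels; rewrite mem_nth.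
have Pn n : P ((in_tuple rels)`_i *+ n).
  by elim: n => [|n IHn]; rewrite ?mulr0n // mulrS; apply: PD.
by case: (a i) => n; [apply: Pn | apply/PN/Pn].
Qed.

Lemma mem_relation_subgroup (X : finType) (rels : seq {ffun X -> int})
    (v : {ffun X -> int}) :
  v \in rels -> v \in relation_subgroup rels.
Proof.
move=> v_rels; have iv : (index v rels < size rels)%N by rewrite index_mem.
apply/asboolP; exists [ffun i => (i == Ordinal iv)%:R].
rewrite (bigD1 (Ordinal iv)) //= ffunE eqxx nth_index // big1 ?addr0 //.
by move=> i /negPf; rewrite ffunE => ->.
Qed.

Lemma presented_abgroup_eq (X : finType) (rels : seq {ffun X -> int})
    (u v : {ffun X -> int}) :
  \pi_(presented_abgroup rels)%qT u = \pi_(presented_abgroup rels)%qT v ->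
  u - v \in relation_subgroup rels.
Proof. by move=> /eqP; rewrite -Quotient.idealrBE. Qed.

(** * Weights on triples that represent relations *)

Section Balanced.
Variables (X E K : finType) (p : E -> K) (i : K -> X) (e0 : E).

(* Subtracting a multiple of [p e0] brings the total weight of v on K to 0;   *)
(* the remainder is the pushforward of x along p.                             *)
Definition balanced (v : {ffun X -> int}) (x : E -> int) :=
  forall k, v (i k) - (\sum_l v (i l)) * (k == p e0)%:R
            = \sum_(e | p e == k) x e.

Lemma balanced0 : balanced 0 (fun=> 0).
Proof. by move=> k; rewrite !big1 ?ffunE ?mul0r ?subr0 // => l; rewrite ffunE. Qed.

Lemma balancedB u v x y :
  balanced u x -> balanced v y -> balanced (u - v) (fun e => x e - y e).
Proof.
move=> bu bv k; rewrite sumrB -bu -bv !ffunE.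
rewrite (eq_bigr (fun l => u (i l) - v (i l))) => [|l _]; last by rewrite !ffunE.
by rewrite sumrB; ring.
Qed.

Lemma sum_delta (k : K) : \sum_l (l == k)%:R = 1 :> int.
Proof. by rewrite (bigD1 k) //= eqxx big1 ?addr0 // => l /negPf->. Qed.

(** For the relations killing [r0], [c0], [s0]: the correction term absorbs them, leaving weight
    0. *)
Lemma balanced_point (v : {ffun X -> int}) (m : int) :
  (forall k, v (i k) = m * (k == p e0)%:R) -> balanced v (fun=> 0).
Proof.
move=> vE k; rewrite (eq_bigr _ (fun l _ => vE l)).
by rewrite -mulr_sumr sum_delta mulr1 vE subrr big1.
Qed.

(** For the relation of the triple [e]: its total is 1, whence the compensating -1 at [e0]. *)
Lemma balanced_delta (v : {ffun X -> int}) e :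
  (forall k, v (i k) = (k == p e)%:R) ->
  balanced v (fun e' => (e' == e)%:R - (e' == e0)%:R).
Proof.
have sumd f k : \sum_(e' | p e' == k) (e' == f)%:R = (k == p f)%:R :> int.
  rewrite big_mkcond (bigD1 f) //= eqxx eq_sym big1 ?addr0; first by case: eqP.
  by move=> e' /negPf->; rewrite if_same.
move=> vE k; rewrite (eq_bigr _ (fun l _ => vE l)).
by rewrite sum_delta mul1r vE sumrB !sumd.
Qed.

Lemma balanced_pushforward0 v x : balanced v x ->
  (forall k, v (i k) = 0) -> forall k, \sum_(e | p e == k) x e = 0.
Proof. by move=> bv v0 k; rewrite -bv v0 big1 ?mul0r ?subr0. Qed.

Lemma balanced_pushforward_diff v x k1 k2 : balanced v x ->
    (forall k, v (i k) = (k == k1)%:R - (k == k2)%:R) ->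
  forall k, \sum_(e | p e == k) x e = (k == k1)%:R - (k == k2)%:R.
Proof.
move=> bv vE k; rewrite -bv vE (eq_bigr _ (fun l _ => vE l)).
by rewrite sumrB !sum_delta subrr mul0r subr0.
Qed.

End Balanced.

(** * Sub-bitrades and connectedness *)

Section Bitrade.
Variables (T : finType).
Implicit Types (W B A D : {set T * T * T}) (t u : T * T * T).

Lemma agreements_ge2 t u :
  (2 <= agreements t u)%N = [|| [&& t.1.2 == u.1.2 & t.2 == u.2],
    [&& t.1.1 == u.1.1 & t.2 == u.2] | [&& t.1.1 == u.1.1 & t.1.2 == u.1.2]].
Proof.
by rewrite /agreements; case: (t.1.1 == _); case: (t.1.2 == _); case: (t.2 == _).
Qed.

Lemma agreements_sym t u : agreements t u = agreements u t.
Proof.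
by rewrite /agreements (eq_sym t.1.1) (eq_sym t.1.2) (eq_sym t.2).
Qed.

Lemma partial_latin_eq A t u : partial_latin A ->
  t \in A -> u \in A -> (2 <= agreements t u)%N -> t = u.
Proof.
move=> lA tA uA tu; apply/eqP; apply: contraTT tu => /(lA t u tA uA).
by rewrite -leqNgt.
Qed.

Lemma has_mates_agree A D : has_mates A D -> forall t, t \in A ->
  [/\ exists2 u, u \in D & (u.1.2, u.2) = (t.1.2, t.2),
      exists2 u, u \in D & (u.1.1, u.2) = (t.1.1, t.2)
    & exists2 u, u \in D & (u.1.1, u.1.2) = (t.1.1, t.1.2)].
Proof.
move=> mAD [[r c] s] /mAD[[r' [[_ h1] _]] [c' [[_ h2] _]] [s' [[_ h3] _]]].
by split; [exists (r', c, s) | exists (r, c', s) | exists (r, c, s')].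
Qed.

(** A mate agrees in two coordinates, so it stays in [D']; its uniqueness is inherited from [D]. *)
Lemma has_mates_sub A D A' D' : has_mates A D ->
    A' \subset A -> D' \subset D ->
    (forall t u, t \in A' -> u \in D -> (2 <= agreements t u)%N -> u \in D') ->
  has_mates A' D'.
Proof.
move=> mAD /subsetP sA /subsetP sD closed r c s tA'.
have [[r' [[nr h1] u1]] [c' [[nc h2] u2]] [s' [[ns h3] u3]]]
  := mAD _ _ _ (sA _ tA').
split; [exists r' | exists c' | exists s'].
- split=> [|x [nx /sD xD]]; last exact: u1.
  by split=> //; apply: closed tA' h1 _; rewrite agreements_ge2 /= !eqxx ?orbT.
- split=> [|x [nx /sD xD]]; last exact: u2.
  by split=> //; apply: closed tA' h2 _; rewrite agreements_ge2 /= !eqxx ?orbT.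
- split=> [|x [nx /sD xD]]; last exact: u3.
  by split=> //; apply: closed tA' h3 _; rewrite agreements_ge2 /= !eqxx ?orbT.
Qed.

Lemma latin_bitrade_sub W B W' B' : latin_bitrade W B ->
    W' \subset W -> B' \subset B -> W' != set0 ->
    (forall t u, t \in W -> u \in B -> (2 <= agreements t u)%N ->
       (t \in W') = (u \in B')) ->
  latin_bitrade W' B'.
Proof.
case=> _ _ rc rs cs lW lB mW mB sW sB W'0 closed.
have mW' : has_mates W' B'.
  apply: (has_mates_sub mW sW sB) => t u tW' uB tu.
  by rewrite -(closed t) // (subsetP sW).
split=> //.
- case/set0Pn: W'0 => t /(has_mates_agree mW')[[u uB _] _ _].
  by apply/set0Pn; exists u.
- by apply: disjointW rc; apply: imsetS.
- by apply: disjointW rs; apply: imsetS.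
- by apply: disjointW cs; apply: imsetS.
- by move=> t u /(subsetP sW) ? /(subsetP sW) ?; apply: lW.
- by move=> t u /(subsetP sB) ? /(subsetP sB) ?; apply: lB.
- apply: (has_mates_sub mB sB sW) => u t uB' tW ut.
  by rewrite (closed _ u) 1?agreements_sym // (subsetP sB).
Qed.

(** Otherwise the closed part and its complement would both be bitrades, splitting [(W, B)]. *)
Lemma connected_closed W B W' B' : latin_bitrade W B -> connected W B ->
    W' \subset W -> B' \subset B ->
    (forall t u, t \in W -> u \in B -> (2 <= agreements t u)%N ->
       (t \in W') = (u \in B')) ->
  W' = set0 \/ W' = W.
Proof.
move=> bWB conn sW sB closed.
have [->|W'0] := eqVneq W' set0; first by left.
have [/eqP|W''0] := eqVneq (W :\: W') set0.
  by rewrite setD_eq0 => sW'; right; apply/eqP; rewrite eqEsubset sW.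
case: conn; exists W', B', (W :\: W'), (B :\: B'); split.
- exact: latin_bitrade_sub sW sB W'0 closed.
- apply: latin_bitrade_sub bWB (subsetDl _ _) (subsetDl _ _) W''0 _ => t u tW uB.
  by rewrite !inE tW uB => /(closed _ _ tW uB)->.
- by rewrite setDE setUIr setUCr setIT; apply/esym/setUidPr.
- by rewrite setDE setUIr setUCr setIT; apply/esym/setUidPr.
- by rewrite setDE setIA setIAC setICr set0I.
Qed.

Lemma rows_mem W t : t \in W -> t.1.1 \in rows W.
Proof. exact: imset_f. Qed.
Lemma cols_mem W t : t \in W -> t.1.2 \in cols W.
Proof. exact: imset_f. Qed.
Lemma syms_mem W t : t \in W -> t.2 \in syms W.
Proof. exact: imset_f. Qed.

Lemma rows_mem_mate W B u : latin_bitrade W B -> u \in B -> u.1.1 \in rows W.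
Proof.
by move=> /bitrade_B_mates mB /(has_mates_agree mB)[_ [t tW [<- _]] _];
  apply: rows_mem.
Qed.
Lemma cols_mem_mate W B u : latin_bitrade W B -> u \in B -> u.1.2 \in cols W.
Proof.
by move=> /bitrade_B_mates mB /(has_mates_agree mB)[[t tW [<- _]] _ _];
  apply: cols_mem.
Qed.
Lemma syms_mem_mate W B u : latin_bitrade W B -> u \in B -> u.2 \in syms W.
Proof.
by move=> /bitrade_B_mates mB /(has_mates_agree mB)[[t tW [_ <-]] _ _];
  apply: syms_mem.
Qed.

End Bitrade.

(** * A connected bitrade of genus 0 as a [sphere] *)

Section SphericalBitrade.
Variables (T : finType) (W B : {set T * T * T}).

Definition row_of (e : {t | t \in W}) : {r | r \in rows W} :=
  exist _ (val e).1.1 (rows_mem (valP e)).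
Definition col_of (e : {t | t \in W}) : {c | c \in cols W} :=
  exist _ (val e).1.2 (cols_mem (valP e)).
Definition sym_of (e : {t | t \in W}) : {s | s \in syms W} :=
  exist _ (val e).2 (syms_mem (valP e)).

Hypothesis WB : latin_bitrade W B.

Definition row_of_mate (f : {u | u \in B}) : {r | r \in rows W} :=
  exist _ (val f).1.1 (rows_mem_mate WB (valP f)).
Definition col_of_mate (f : {u | u \in B}) : {c | c \in cols W} :=
  exist _ (val f).1.2 (cols_mem_mate WB (valP f)).
Definition sym_of_mate (f : {u | u \in B}) : {s | s \in syms W} :=
  exist _ (val f).2 (syms_mem_mate WB (valP f)).

Lemma bitrade_sphere : connected W B ->
    2 + #|W|%:Z - #|rows W|%:Z - #|cols W|%:Z - #|syms W|%:Z = 0 :> int ->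
  exists b1 b2 b3,
    sphere row_of col_of sym_of row_of_mate col_of_mate sym_of_mate b1 b2 b3.
Proof.
move=> conn genus; case: (WB) => _ _ _ _ _ lW lB mW mB.
have cs_inj (A : {set T * T * T}) :
    partial_latin A -> {in A &, injective (fun t => (t.1.2, t.2))}.
  move=> lA t u tA uA [tc ts]; apply: partial_latin_eq lA tA uA _.
  by rewrite agreements_ge2 tc ts !eqxx.
have rs_inj (A : {set T * T * T}) :
    partial_latin A -> {in A &, injective (fun t => (t.1.1, t.2))}.
  move=> lA t u tA uA [tr ts]; apply: partial_latin_eq lA tA uA _.
  by rewrite agreements_ge2 tr ts !eqxx orbT.
have rc_inj (A : {set T * T * T}) :
    partial_latin A -> {in A &, injective (fun t => (t.1.1, t.1.2))}.
  move=> lA t u tA uA [tr tc]; apply: partial_latin_eq lA tA uA _.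
  by rewrite agreements_ge2 tr tc !eqxx !orbT.
have [b1 b1_bij b1P] := mate_bijection (cs_inj W lW) (cs_inj B lB)
  (fun t tW => let: And3 h _ _ := has_mates_agree mW tW in h)
  (fun t tB => let: And3 h _ _ := has_mates_agree mB tB in h).
have [b2 b2_bij b2P] := mate_bijection (rs_inj W lW) (rs_inj B lB)
  (fun t tW => let: And3 _ h _ := has_mates_agree mW tW in h)
  (fun t tB => let: And3 _ h _ := has_mates_agree mB tB in h).
have [b3 b3_bij b3P] := mate_bijection (rc_inj W lW) (rc_inj B lB)
  (fun t tW => let: And3 _ _ h := has_mates_agree mW tW in h)
  (fun t tB => let: And3 _ _ h := has_mates_agree mB tB in h).
exists b1, b2, b3; split=> //.
- by move=> e; apply: val_inj; case: (b1P e).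
- by move=> e; apply: val_inj; case: (b1P e).
- by move=> e; apply: val_inj; case: (b2P e).
- by move=> e; apply: val_inj; case: (b2P e).
- by move=> e; apply: val_inj; case: (b3P e).
- by move=> e; apply: val_inj; case: (b3P e).
- move=> e e' [ec] [es]; apply/val_inj/(cs_inj W) => //; try exact: valP.
  by rewrite /= ec es.
- move=> e e' [er] [es]; apply/val_inj/(rs_inj W) => //; try exact: valP.
  by rewrite /= er es.
- move=> e e' [er] [ec]; apply/val_inj/(rc_inj W) => //; try exact: valP.
  by rewrite /= er ec.
- case=> r rW; case/imsetP: (rW) => t tW rt.
  by exists (exist _ t tW); apply: val_inj.
- case=> r rW; case/imsetP: (rW) => t tW rt.
  by exists (exist _ t tW); apply: val_inj.
- case=> r rW; case/imsetP: (rW) => t tW rt.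
  by exists (exist _ t tW); apply: val_inj.
(* A black triple agreeing with a white one in two coordinates is its image under [b1], [b2] or
   [b3], so [P] and [Q] cut out closed sets of triples. *)
- move=> P Q PQ1 PQ2 PQ3 e e'.
  pose W' := [set val e | e in P]; pose B' := [set val f | f in Q].
  have memW' e1 : (val e1 \in W') = P e1 by rewrite mem_imset //; apply: val_inj.
  have memB' f1 : (val f1 \in B') = Q f1 by rewrite mem_imset //; apply: val_inj.
  have [||t u tW uB|W'E|W'E] := @connected_closed _ W B W' B' WB conn.
  + by apply/subsetP => _ /imsetP[e1 _ ->]; apply: valP.
  + by apply/subsetP => _ /imsetP[e1 _ ->]; apply: valP.
  + rewrite agreements_ge2 -[t]/(val (exist (fun t => t \in W) t tW)).
    rewrite -[u]/(val (exist (fun t => t \in B) u uB)) memW' memB'.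
    set e1 := exist _ t tW; set f1 := exist _ u uB.
    case/or3P=> /andP[/eqP h1 /eqP h2].
    * rewrite PQ1; congr Q; apply/val_inj/(cs_inj B) => //; try exact: valP.
      by rewrite /= b1P h1 h2.
    * rewrite PQ2; congr Q; apply/val_inj/(rs_inj B) => //; try exact: valP.
      by rewrite /= b2P h1 h2.
    * rewrite PQ3; congr Q; apply/val_inj/(rc_inj B) => //; try exact: valP.
      by rewrite /= b3P h1 h2.
  + by rewrite -!memW' W'E !inE.
  + rewrite -!memW' W'E; transitivity true; first exact: valP.
    exact/esym/valP.
- rewrite !card_sig; move: genus.
  have cardE (X : finType) (A : {set X}) : #|[pred x | x \in A]| = #|A|.
    exact: eq_card.
  by rewrite !cardE; lia.
Qed.

End SphericalBitrade.

Lemma disjoint_neqF (T : finType) (A D : {set T}) (x y : T) :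
  [disjoint A & D] -> x \in A -> y \in D ->
  ((x == y) = false) * ((y == x) = false).
Proof.
move=> dAD xA yD; have xy : x != y.
  by apply: contraTneq yD => <-; rewrite (disjointFr dAD).
by rewrite [y == x]eq_sym (negPf xy).
Qed.

(** * The relations of the group, and the embedding *)

Section AstarEmbedding.
Variables (T : finType) (W B : {set T * T * T}).

Lemma vars_row (x : T) : x \in rows W -> x \in vars W.
Proof. by rewrite !inE => ->. Qed.
Lemma vars_col (x : T) : x \in cols W -> x \in vars W.
Proof. by rewrite !inE => ->; rewrite orbT. Qed.
Lemma vars_sym (x : T) : x \in syms W -> x \in vars W.
Proof. by rewrite !inE => ->; rewrite orbT. Qed.

Definition row_var (r : {r | r \in rows W}) : {v | v \in vars W} :=
  exist _ (val r) (vars_row (valP r)).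
Definition col_var (c : {c | c \in cols W}) : {v | v \in vars W} :=
  exist _ (val c) (vars_col (valP c)).
Definition sym_var (s : {s | s \in syms W}) : {v | v \in vars W} :=
  exist _ (val s) (vars_sym (valP s)).

Hypothesis WB : latin_bitrade W B.

Lemma gen_row (r : {r | r \in rows W}) :
  [/\ forall k, gen W (val r) (row_var k) = (k == r)%:R,
      forall k, gen W (val r) (col_var k) = 0
    & forall k, gen W (val r) (sym_var k) = 0].
Proof.
split=> k; rewrite ffunE //=.
  by rewrite (disjoint_neqF (bitrade_rows_cols WB) (valP r) (valP k)).
by rewrite (disjoint_neqF (bitrade_rows_syms WB) (valP r) (valP k)).
Qed.

Lemma gen_col (c : {c | c \in cols W}) :
  [/\ forall k, gen W (val c) (row_var k) = 0,
      forall k, gen W (val c) (col_var k) = (k == c)%:R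
    & forall k, gen W (val c) (sym_var k) = 0].
Proof.
split=> k; rewrite ffunE //=.
  by rewrite (disjoint_neqF (bitrade_rows_cols WB) (valP k) (valP c)).
by rewrite (disjoint_neqF (bitrade_cols_syms WB) (valP c) (valP k)).
Qed.

Lemma gen_sym (s : {s | s \in syms W}) :
  [/\ forall k, gen W (val s) (row_var k) = 0,
      forall k, gen W (val s) (col_var k) = 0
    & forall k, gen W (val s) (sym_var k) = (k == s)%:R].
Proof.
split=> k; rewrite ffunE //=.
  by rewrite (disjoint_neqF (bitrade_rows_syms WB) (valP k) (valP s)).
by rewrite (disjoint_neqF (bitrade_cols_syms WB) (valP k) (valP s)).
Qed.

(** The same [x] serves rows, columns and symbols. Balance survives differences, so only the
    defining relations need a witness. *)
Lemma Astar_relation_balanced (e0 : {t | t \in W}) v :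
    v \in relation_subgroup
      (Astar_rels W (val e0).1.1 (val e0).1.2 (val e0).2) ->
  exists x, [/\ balanced (@row_of _ W) row_var e0 v x,
    balanced (@col_of _ W) col_var e0 v x
    & balanced (@sym_of _ W) sym_var e0 v x].
Proof.
move: v; apply: relation_subgroup_ind => [|u v [x [xr xc xs]] [y [yr yc ys]]|v].
- by exists (fun=> 0); split; apply: balanced0.
- by exists (fun e => x e - y e); split; apply: balancedB.
rewrite mem_cat => /orP[/mapP[t tW ->]|].
  rewrite mem_enum in tW; pose e : {t | t \in W} := exist _ t tW.
  exists (fun e' => (e' == e)%:R - (e' == e0)%:R).
  have [rr rc rs] := gen_row (row_of e).
  have [cr cc cs] := gen_col (col_of e).
  have [sr sc ss] := gen_sym (sym_of e).
  split; apply: balanced_delta => k; rewrite 2!ffunE.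
  - by rewrite rr cr sr !addr0.
  - by rewrite rc cc sc addr0 add0r.
  - by rewrite rs cs ss !add0r.
rewrite !inE => /or3P[] /eqP->; exists (fun=> 0).
- have [rr rc rs] := gen_row (row_of e0); split.
  + by apply: (balanced_point (m := 1)) => k; rewrite rr mul1r.
  + by apply: (balanced_point (m := 0)) => k; rewrite rc mul0r.
  + by apply: (balanced_point (m := 0)) => k; rewrite rs mul0r.
- have [cr cc cs] := gen_col (col_of e0); split.
  + by apply: (balanced_point (m := 0)) => k; rewrite cr mul0r.
  + by apply: (balanced_point (m := 1)) => k; rewrite cc mul1r.
  + by apply: (balanced_point (m := 0)) => k; rewrite cs mul0r.
- have [sr sc ss] := gen_sym (sym_of e0); split.
  + by apply: (balanced_point (m := 0)) => k; rewrite sr mul0r.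
  + by apply: (balanced_point (m := 0)) => k; rewrite sc mul0r.
  + by apply: (balanced_point (m := 1)) => k; rewrite ss mul1r.
Qed.

End AstarEmbedding.

Theorem theorem4p10 (T : finType) (W B : {set T * T * T}) (r0 c0 s0 : T)
    (hWB : spherical W B) (h0 : (r0, c0, s0) \in W) :
  embeds_in W (Astar W r0 c0 s0).
Proof.
case: hWB => WB _ conn genus.
have [b1 [b2 [b3 sphR]]] := bitrade_sphere WB conn genus.
have sphC := sphere_rot sphR; have sphS := sphere_rot sphC.
pose e0 : {t | t \in W} := exist _ (r0, c0, s0) h0.
pose cls (x : T) : Astar W r0 c0 s0 := \pi_(Astar W r0 c0 s0)%qT (gen W x).
have clsE x y : cls x = cls y -> exists z,
    [/\ balanced (@row_of _ W) (@row_var _ W) e0 (gen W x - gen W y) z,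
      balanced (@col_of _ W) (@col_var _ W) e0 (gen W x - gen W y) z
      & balanced (@sym_of _ W) (@sym_var _ W) e0 (gen W x - gen W y) z].
  by move=> /presented_abgroup_eq xy; apply: (Astar_relation_balanced WB).
(* The relations read r + c + s = 0 while an embedding asks for f r + h c = k s, hence the sign on
   symbols. *)
exists cls, cls, (fun s => - cls s); split.
- move=> x y xR yR /clsE[z [zr zc zs]].
  pose kx : {r | r \in rows W} := exist _ x xR.
  pose ky : {r | r \in rows W} := exist _ y yR.
  have [xr xc xs] := gen_row WB kx; have [yr yc ys] := gen_row WB ky.
  suff /(congr1 val) : kx = ky by [].
  apply: (sphere_row_separation sphR (x := z)).
  + by apply: (balanced_pushforward0 zc) => k;
    rewrite ffunE [X in _ + X]ffunE xc yc subrr.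
  + by apply: (balanced_pushforward0 zs) => k;
    rewrite ffunE [X in _ + X]ffunE xs ys subrr.
  + by apply: (balanced_pushforward_diff zr) => k;
    rewrite ffunE [X in _ + X]ffunE xr yr.
- move=> x y xC yC /clsE[z [zr zc zs]].
  pose kx : {c | c \in cols W} := exist _ x xC.
  pose ky : {c | c \in cols W} := exist _ y yC.
  have [xr xc xs] := gen_col WB kx; have [yr yc ys] := gen_col WB ky.
  suff /(congr1 val) : kx = ky by [].
  apply: (sphere_row_separation sphC (x := z)).
  + by apply: (balanced_pushforward0 zs) => k;
    rewrite ffunE [X in _ + X]ffunE xs ys subrr.
  + by apply: (balanced_pushforward0 zr) => k;
    rewrite ffunE [X in _ + X]ffunE xr yr subrr.
  + by apply: (balanced_pushforward_diff zc) => k;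
    rewrite ffunE [X in _ + X]ffunE xc yc.
- move=> x y xS yS /oppr_inj/clsE[z [zr zc zs]].
  pose kx : {s | s \in syms W} := exist _ x xS.
  pose ky : {s | s \in syms W} := exist _ y yS.
  have [xr xc xs] := gen_sym WB kx; have [yr yc ys] := gen_sym WB ky.
  suff /(congr1 val) : kx = ky by [].
  apply: (sphere_row_separation sphS (x := z)).
  + by apply: (balanced_pushforward0 zr) => k;
    rewrite ffunE [X in _ + X]ffunE xr yr subrr.
  + by apply: (balanced_pushforward0 zc) => k;
    rewrite ffunE [X in _ + X]ffunE xc yc subrr.
  + by apply: (balanced_pushforward_diff zs) => k;
    rewrite ffunE [X in _ + X]ffunE xs ys.
- move=> r c s tW; apply/eqP; rewrite -addr_eq0 /cls.
  rewrite -!raddfD -(raddf0 (\pi_(Astar W r0 c0 s0)%qT)) -Quotient.idealrBE subr0.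
  apply: mem_relation_subgroup; rewrite mem_cat; apply/orP; left.
  by apply/mapP; exists (r, c, s); rewrite ?mem_enum.
Qed.
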